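(* Let $m$ be a fixed positive odd integer, and for integers $n \ge 1$ let \[ F^W_{m,n}(x) = (x(x+1))^m x^{4n} - (x-1)^m \in \mathbb{Z}[x]. \] There is an integer $N = N(m)$ such that for every integer $n \ge N$ with $\gcd(n,m) = 1$, the polynomial $F^W_{m,n}(x)$ equals $x^2+1$ times a polynomial that is irreducible over $\mathbb{Q}$ (equivalently, $x^2+1$ divides $F^W_{m,n}(x)$ and $F^W_{m,n}(x)/(x^2+1)$ is irreducible in $\mathbb{Z}[x]$). *)

(* Defs.v *)
From mathcomp Require Import all_boot all_order all_algebra.
Set Implicit Arguments. Unset Strict Implicit. Unset Printing Implicit Defensive.
Import GRing.Theory Num.Theory.
Local Open Scope ring_scope.

Definition FW (m n : nat) : {poly rat} :=
  ('X * ('X + 1)) ^+ m * 'X ^+ (4 * n) - ('X - 1) ^+ m.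

(* Main.v *)
Require Import Defs.
From mathcomp Require Import all_boot all_order all_algebra.
From mathcomp Require Import all_field generic_quotient zify ring.
Set Implicit Arguments. Unset Strict Implicit. Unset Printing Implicit Defensive.
Import Order.TTheory GRing.Theory Num.Theory.

(** Write F for [FW m n], D = 4n + 2m for its degree, and P~ for the reciprocal
    of P. If F = A B over Z, then W = A~ B satisfies W W~ = F F~, so W has the
    same Euclidean norm as F, which is bounded in terms of m; hence W has boundedly
    many terms. For n large, Dirichlet's simultaneous approximation gives
    4n = k q + r such that each exponent of W is a multiple of k up to an error small
    compared with k, and the identity lifts, through y = x^k, to an identity
    between bivariate polynomials. There F lifts to
    (x(x+1))^m x^r y^q - (x-1)^m, which is irreducible over Q(x) because
    gcd(q, m, r) = 1: the norm of a root of a factor of degree d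
    forces q | d. So F divides W or W~, which means that A or B divides F~. Finally, a common root x of F and F~ satisfies |x| = 1 and
    |x - 1| = |x + 1|, i.e. x^2 = -1, and these are simple roots of F. *)

(** * Simultaneous approximation of exponents *)

(** Pigeonhole: sort the fractional parts of j t / L, for t in [s] and j up to [Q ^ size s], into
    [Q] intervals of length 1/Q. Two indices share all intervals, and their difference is [q]. The
    conclusion is |q t / L - a t| <= 1/Q cleared of denominators. *)
Lemma simultaneous_approx (L Q : nat) (s : seq nat) : 0 < L -> 0 < Q ->
  exists (q : nat) (a : nat -> nat), 0 < q <= Q ^ size s /\
    forall t, t \in s ->
      Q * (q * t) <= Q * (a t * L) + L /\ Q * (a t * L) <= Q * (q * t) + L.
Proof.
move=> L0 Q0.
have bucket_lt x : ((x %% L) * Q) %/ L < Q.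
  by rewrite ltn_divLR // mulnC ltn_pmul2l // ltn_pmod.
pose f (j : 'I_(Q ^ size s).+1) : {ffun 'I_(size s) -> 'I_Q} :=
  [ffun i : 'I_(size s) => Ordinal (bucket_lt (j * nth 0 s i))].
have [i [j [ltij fij]]] : exists i j : 'I_(Q ^ size s).+1, i < j /\ f i = f j.
  have /injectivePn[i [j neij fij]] : ~~ injectiveb f.
    apply/injectiveP => /leq_card; rewrite card_ffun !card_ord.
    by rewrite ltnn.
  have [ltij|ltji|/val_inj eqij] := ltngtP i j; first by exists i, j.
    by exists j, i.
  by rewrite eqij eqxx in neij.
exists (j - i), (fun t => (j * t) %/ L - (i * t) %/ L).
split; first by rewrite subn_gt0 ltij /= (leq_trans (leq_subr _ _)) // -ltnS.
move=> t /(nthP 0)[l ls <-].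
have := congr1 (fun g : {ffun 'I_(size s) -> 'I_Q} => val (g (Ordinal ls))) fij.
rewrite /= !ffunE /=; set t' := nth 0 s l => E.
have le_div : (i * t') %/ L <= (j * t') %/ L.
  by rewrite leq_div2r // leq_mul2r (ltnW ltij) orbT.
have := divn_eq (i * t') L; have := divn_eq (j * t') L.
have := ltn_ceil ((i * t') %% L * Q) L0; have := leq_trunc_div ((i * t') %% L * Q) L.
have := ltn_ceil ((j * t') %% L * Q) L0; have := leq_trunc_div ((j * t') %% L * Q) L.
rewrite -E; set b := (_ * Q) %/ L.
set aj := (j * t') %/ L in le_div *; set ai := (i * t') %/ L in le_div *.
rewrite mulSn !mulnBl => j1 j2 i1 i2 ej ei.
have le_L : Q * (ai * L) <= Q * (aj * L) by rewrite leq_mul2l leq_mul2r le_div !orbT.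
have le_ij : Q * (i * t') <= Q * (j * t').
  by rewrite leq_mul2l leq_mul2r (ltnW ltij) !orbT.
have ej' : Q * (j * t') = Q * (aj * L) + (j * t') %% L * Q by rewrite {1}ej; lia.
have ei' : Q * (i * t') = Q * (ai * L) + (i * t') %% L * Q by rewrite {1}ei; lia.
rewrite !mulnBr.
move: (Q * (aj * L)) (Q * (ai * L)) ((j * t') %% L * Q) ((i * t') %% L * Q)
  (Q * (j * t')) (Q * (i * t')) (b * L) le_L le_ij j1 j2 i1 i2 ej' ei'.
by move=> *; lia.
Qed.

(** Approximation with L = 4n and Q = 8 puts t within about k/8 of (a t) 4n / q; replacing 4n / q by
    its integer part [k] costs at most [q] more. Since [q] is at most 8^M, [k] is large when [n] is,
    so such an error stays below k/6. *)
Lemma exponent_clusters (m M : nat) : exists N : nat, forall n : nat, N <= n ->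
  forall s : seq nat, size s <= M -> all (fun t => t <= 4 * n + 2 * m) s ->
  exists (q k r S : nat) (a : nat -> nat),
    [/\ 0 < q, 4 * n = k * q + r, 2 * m + r <= S, 6 * S < k &
      forall t, t \in s -> [/\ a t <= q, k * a t <= t + S & t <= k * a t + S]].
Proof.
pose B := 8 ^ M.
(* This forces k >= 30 (B + 2m + 4), which beats the 24 (q + 2m + 2) needed for 6 S < k with the [S]
   chosen below. *)
exists (B * (30 * (B + 2 * m + 4))) => n leNn s sM /allP s_le.
have B0 : 0 < B by rewrite expn_gt0.
have n0 : 0 < 4 * n by nia.
have [q [a [/andP[q0 qs] qa]]] := simultaneous_approx s n0 (isT : 0 < 8).
have qB : q <= B by rewrite (leq_trans qs) // leq_pexp2l.
pose k := (4 * n) %/ q; pose r := (4 * n) %% q.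
have E : 4 * n = k * q + r by exact: divn_eq.
have rq : r < q by rewrite ltn_pmod.
have k_ge : 30 * (B + 2 * m + 4) <= k.
  rewrite leq_divRL //; nia.
exists q, k, r, (k %/ 8 + q + 2 * m + 2), a.
have k8 := divn_eq k 8; have k8' : k %% 8 < 8 by rewrite ltn_pmod.
split=> //; try lia.
move=> t ts; have [h1 h2] := qa t ts; have /= tD := s_le t ts.
(* Exponents may exceed 4n, but only by 2m; a t >= q + 1 would give 4n <= 2 m q + n/2, false for
   large n. *)
have aq : a t <= q.
  rewrite leqNgt; apply/negP => ltqa.
  have : (q + 1) * (4 * n) <= a t * (4 * n) by rewrite leq_mul2r; apply/orP; right; lia.
  have : q * t <= q * (4 * n + 2 * m) by rewrite leq_mul2l tD orbT.
  have : q * m <= B * m by rewrite leq_mul2r qB orbT.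
  have : B * m * 20 <= n by nia.
  nia.
have ar : a t * r <= q * q by apply: leq_mul => //; exact: ltnW.
have h1' : 8 * (q * t) <= 8 * (q * (k * a t)) + 8 * (q * q) + k * q + r by nia.
have h2' : 8 * (q * (k * a t)) <= 8 * (q * t) + k * q + r by nia.
have K : k * q <= q * (8 * (k %/ 8) + 8) by nia.
split=> //.
  have : q * (k * a t) <= q * (t + (k %/ 8 + q + 2 * m + 2)) by nia.
  by rewrite leq_pmul2l.
have : q * t <= q * (k * a t + (k %/ 8 + q + 2 * m + 2)) by nia.
by rewrite leq_pmul2l.
Qed.

Local Open Scope ring_scope.

Local Notation pZtoQ := (map_poly (intr : int -> rat)).
Local Notation pQtoC := (map_poly (ratr : rat -> algC)).

(** * Factors of binomials over a function field *)

(** For monic [P], beta is the determinant of the companion matrix A, that is, the norm of a root.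
    By Cayley-Hamilton a A^q = b I; take determinants. *)
Lemma binomial_dvdp_norm (K : fieldType) (q : nat) (a b : K) (P : {poly K}) :
  P != 0 -> P %| a *: 'X^q - b%:P ->
  exists beta : K, a ^+ (size P).-1 * beta ^+ q = b ^+ (size P).-1.
Proof.
wlog Pm : P / P \is monic => [hw P0 dvP|].
  have c0 : (lead_coef P)^-1 != 0 by rewrite invr_eq0 lead_coef_eq0.
  have := hw ((lead_coef P)^-1 *: P); rewrite size_scale // scaler_eq0 negb_or c0 P0.
  rewrite dvdpZl //; apply=> //.
  by rewrite monicE lead_coefZ mulVf // lead_coef_eq0.
move=> P0 dvP.
have [n eqn] : exists n, n = (size P).-1 by exists (size P).-1.
case: n eqn => [|n] eqn; rewrite -eqn.
  by exists 1; rewrite !expr0 expr1n mul1r.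
have [A chA] : exists A : 'M[K]_n.+1, char_poly A = P.
  by rewrite eqn; exists (companionmx P); exact: companionmxK.
exists (\det A).
have : horner_mx A (a *: 'X^q - b%:P) = 0.
  by have /dvdpP[c ->] := dvP; rewrite rmorphM /= -{1}chA Cayley_Hamilton mulr0.
rewrite rmorphB /= linearZ /= rmorphXn /= horner_mx_X horner_mx_C => /subr0_eq E.
rewrite -(det_scalar n.+1 b) -E detZ; congr (_ * _).
by elim: q {dvP E} => [|q IHq]; rewrite ?expr0 ?det1 // !exprS det_mulmx IHq.
Qed.

Lemma fraction_repr (R : idomainType) (x : {fraction R}) :
  exists n d : R, d != 0 /\ x * FracField.tofrac d = FracField.tofrac n.
Proof.
elim/quotW: x => x; exists (frac x).1, (frac x).2; split; first exact: denom_ratioP.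
unlock FracField.tofrac; rewrite -[LHS]FracField.pi_mul /FracField.mulf.
have d0 := denom_ratioP x.
apply/eqmodP; rewrite /= FracField.equivfE.
by rewrite !numden_Ratio ?mulr1 ?oner_eq0 ?d0 // mulrC.
Qed.

Lemma mup_exp (F : fieldType) (x : F) (p : {poly F}) n :
  p != 0 -> mup x (p ^+ n) = (n * mup x p)%N.
Proof.
move=> p0; elim: n => [|n IHn]; first by rewrite expr0 mupNroot // root1.
by rewrite exprS mupM ?expf_neq0 // IHn mulSn.
Qed.

Lemma coprime3_dvdn m r q d : gcdn q (gcdn m r) = 1%N ->
  (q %| m * d)%N -> (q %| (m + r) * d)%N -> (q %| d)%N.
Proof.
move=> cop q1 q2.
have q3 : (q %| r * d)%N by move: q2; rewrite mulnDl dvdn_addr.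
by rewrite -(@Gauss_dvdr _ (gcdn m r)) // /coprime ?cop // muln_gcdl dvdn_gcd q1 q3.
Qed.

(* Comparing the multiplicities at x = 1 and x = 0 of the two sides of the norm
   equation, where e is the degree of P, shows that q divides m e and (m + r) e. *)
Lemma binomial_factor_degree (m r q : nat) (P : {poly {fraction {poly rat}}}) :
  (0 < q)%N -> gcdn q (gcdn m r) = 1%N -> P != 0 ->
  P %| FracField.tofrac (('X * ('X + 1)) ^+ m * 'X ^+ r : {poly rat}) *: 'X^q
       - (FracField.tofrac (('X - 1) ^+ m : {poly rat}))%:P ->
  (q %| (size P).-1)%N.
Proof.
move=> q0 cop P0 /(binomial_dvdp_norm P0)[b]; set e := (size P).-1.
have [n [d [d0 Eb]]] := fraction_repr b.
set c1 := (_ * 'X ^+ r); set c0 := _ ^+ m => E.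
have X0 : ('X : {poly rat}) != 0 by rewrite polyX_eq0.
have X1E : ('X + 1 : {poly rat}) = 'X - (-1)%:P by rewrite polyCN opprK.
have XmE : ('X - 1 : {poly rat}) = 'X - 1%:P by [].
have X10 : ('X + 1 : {poly rat}) != 0 by rewrite X1E polyXsubC_eq0.
have Xm0 : ('X - 1 : {poly rat}) != 0 by rewrite XmE polyXsubC_eq0.
have c10 : c1 != 0 by rewrite /c1 !(mulf_neq0, expf_neq0).
have c00 : c0 != 0 by rewrite /c0 expf_neq0.
have En : c1 ^+ e * n ^+ q = c0 ^+ e * d ^+ q.
  move: (c1) (c0) E => u v E.
  apply/eqP; rewrite -tofrac_eq !rmorphM !rmorphXn /=.
  by rewrite -E -Eb exprMn mulrA.
have n0 : n != 0.
  apply: contra_eq_neq En => ->; rewrite eq_sym expr0n gtn_eqF // mulr0.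
  by rewrite mulf_neq0 ?expf_neq0.
(* Multiplicity of x in both sides of [En]; the booleans record the roots 0 and -1 of [c1] and the
   root 1 of [c0]. *)
have mupE (x : rat) :
    (e * (m * ((x == 0%R) + (x == (-1)%R)) + r * (x == 0%R)) + q * mup x n = e * (m * (x == 1%R)) + q * mup x d)%N.
  have := congr1 (mup x) En; rewrite !mupM ?expf_neq0 // !mup_exp //.
  rewrite mupM ?(expf_neq0, mulf_neq0) // !mup_exp ?mulf_neq0 // mupM //.
  have mX : mup x 'X = (x == 0) :> nat.
    by rewrite -['X]expr1 -['X]subr0 -polyC0 mup_XsubCX eq_sym; case: eqP.
  rewrite mX X1E XmE -['X - (-1)%:P]expr1 -['X - 1%:P]expr1 !mup_XsubCX.
  by rewrite !(eq_sym _ x); do 3!case: eqP.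
apply: (coprime3_dvdn cop).
  have := mupE 1; rewrite eqxx muln1 (_ : 1 == 0 = false) // (_ : 1 == -1 = false) //.
  rewrite !muln0 add0n => E1.
  have : (q %| e * m + q * mup 1%R d)%N by rewrite -E1 dvdn_mulr.
  by rewrite dvdn_addl; [rewrite mulnC | exact: dvdn_mulr].
have := mupE 0; rewrite eqxx (_ : 0 == 1 = false) // (_ : 0 == -1 = false) //.
rewrite !muln0 add0n !muln1 => E1.
have : (q %| e * (m + r) + q * mup 0%R n)%N by rewrite E1 dvdn_mulr.
by rewrite dvdn_addl; [rewrite mulnC | exact: dvdn_mulr].
Qed.

Section BinomialFactor.
Variables (R : idomainType) (K : fieldType) (f : {rmorphism R -> K}).
Hypothesis f_inj : injective f.
Variables (q : nat) (a b : R).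
Hypotheses (q_gt0 : (0 < q)%N) (a_neq0 : a != 0).

Let B : {poly R} := a%:P * 'X^q - b%:P.

Lemma map_binomial : map_poly f B = f a *: 'X^q - (f b)%:P.
Proof. by rewrite rmorphB rmorphM /= !map_polyC rmorphXn /= map_polyX mul_polyC. Qed.

Lemma size_map_binomial : size (map_poly f B) = q.+1.
Proof.
have fa0 : f a != 0 by rewrite -(rmorph0 f) (inj_eq f_inj).
rewrite map_binomial size_polyDl size_scale // size_polyXn // size_polyN.
by rewrite (leq_ltn_trans (size_polyC_leq1 _)).
Qed.

(** The degree bound makes the quotient a constant, determined by the coefficient of index [q].
    Multiplying by [a] brings the relation back from K to R, where the variable can later be
    specialized. *)
Lemma dvdp_map_binomial (P : {poly R}) : (size P <= q.+1)%N ->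
  map_poly f B %| map_poly f P -> a%:P * P = (P`_q)%:P * B.
Proof.
move=> sP /dvdpP[Q EQ].
have F0 : map_poly f B != 0 by rewrite -size_poly_eq0 size_map_binomial.
have /size1_polyC EQ' : (size Q <= 1)%N.
  have [->|Q0] := eqVneq Q 0; first by rewrite size_poly0.
  move: sP; rewrite -(size_map_inj_poly f_inj (rmorph0 f)).
  by rewrite EQ size_mul // size_map_binomial addnS /= -add1n leq_add2r.
move: EQ; rewrite EQ'; set u := Q`_0 => EQ.
have Pq : f P`_q = u * f a.
  rewrite -coef_map EQ coefCM map_binomial coefB coefZ coefXn coefC eqxx mulr1.
  by rewrite gtn_eqF // subr0.
apply: (map_inj_poly f_inj (rmorph0 f)).
rewrite [LHS]rmorphM [RHS]rmorphM /= !map_polyC EQ /= Pq mulrA -polyCM.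
by rewrite [f a * u]mulrC.
Qed.

(** The gcd of the binomial and [P] has degree 0 or q by the hypothesis on divisors, so the binomial
    is coprime to [P] or divides it. *)
Lemma binomial_dvdp_mul (P Q C : {poly R}) :
  (forall G : {poly K}, G != 0 -> G %| f a *: 'X^q - (f b)%:P -> (q %| (size G).-1)%N) ->
  (size P <= q.+1)%N -> (size Q <= q.+1)%N ->
  P * Q = C * B ->
  a%:P * P = (P`_q)%:P * B \/ a%:P * Q = (Q`_q)%:P * B.
Proof.
move=> dgF sP sQ /(congr1 (map_poly f)); rewrite [LHS]rmorphM [RHS]rmorphM /= => EPQ.
have dvPQ : map_poly f B %| map_poly f P * map_poly f Q by rewrite EPQ dvdp_mull.
have sF := size_map_binomial.
have F0 : map_poly f B != 0 by rewrite -size_poly_eq0 sF.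
have dvG := dvdp_gcdl (map_poly f B) (map_poly f P).
have dvG' := dvdp_gcdr (map_poly f B) (map_poly f P).
set G := gcdp _ _ in dvG dvG'.
have G0 : G != 0 by rewrite gcdp_eq0 negb_and F0.
have qG : (q %| (size G).-1)%N by apply: dgF; rewrite -?map_binomial.
have sG : (size G <= q.+1)%N by rewrite -sF dvdp_leq.
have := size_poly_gt0 G; rewrite G0 => sG0.
have [/eqP e0|e0] := posnP (size G).-1.
  have copFP : coprimep (map_poly f B) (map_poly f P).
    by rewrite /coprimep -/G -(prednK sG0) (eqP e0).
  by right; apply: dvdp_map_binomial => //; rewrite -(Gauss_dvdpr _ copFP).
left; apply: dvdp_map_binomial => //.
have sGq : size G == q.+1.
  by rewrite eqn_leq sG -(prednK sG0) ltnS dvdn_leq.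
have : G %= map_poly f B by rewrite -dvdp_size_eqp // sF.
by move=> /eqp_dvdl <-.
Qed.

End BinomialFactor.

(** * Reciprocal polynomials *)

(** This is x^d p(1/x) for p of degree at most d. Keeping [d] separate from the degree of [p] makes
    the operation linear. *)
Definition recip (R : nzRingType) (d : nat) (p : {poly R}) : {poly R} :=
  \poly_(i < d.+1) p`_(d - i).

Section Reciprocal.
Variable R : comNzRingType.
Implicit Types p q : {poly R}.

Lemma coef_recip d p i : (recip d p)`_i = if (i <= d)%N then p`_(d - i) else 0.
Proof. by rewrite coef_poly ltnS. Qed.

Lemma size_recip d p : (size (recip d p) <= d.+1)%N.
Proof. exact: size_poly. Qed.

Lemma recipK d p : (size p <= d.+1)%N -> recip d (recip d p) = p.
Proof.
move=> sp; apply/polyP => i; rewrite !coef_recip leq_subr.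
by case: leqP => [le_id|lt_di]; [rewrite subKn | rewrite nth_default // (leq_trans sp)].
Qed.

Lemma recipD d p q : recip d (p + q) = recip d p + recip d q.
Proof.
by apply/polyP => i; rewrite coefD !coef_recip coefD; case: ifP; rewrite ?addr0.
Qed.

Lemma recipZ d c p : recip d (c *: p) = c *: recip d p.
Proof.
by apply/polyP => i; rewrite coefZ !coef_recip coefZ; case: ifP; rewrite ?mulr0.
Qed.

Lemma recip0 d : recip d (0 : {poly R}) = 0.
Proof. by apply/polyP => i; rewrite coef_recip !coef0 if_same. Qed.

Lemma recipN d p : recip d (- p) = - recip d p.
Proof. by rewrite -scaleN1r recipZ scaleN1r. Qed.

Lemma recip_sum d n (f : 'I_n -> {poly R}) :
  recip d (\sum_(i < n) f i) = \sum_(i < n) recip d (f i).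
Proof. exact: (big_morph _ (recipD d) (recip0 d)). Qed.

Lemma recipXn d i : (i <= d)%N -> recip d 'X^i = 'X^(d - i) :> {poly R}.
Proof.
move=> le_id; apply/polyP => j; rewrite coef_recip !coefXn.
case: leqP => le_jd; first by congr (_%:R); lia.
by rewrite gtn_eqF // (leq_ltn_trans (leq_subr _ _)).
Qed.

Lemma recip1 d : recip d 1 = 'X^d :> {poly R}.
Proof. by rewrite -(expr0 'X) recipXn // subn0. Qed.

Lemma recip_polyX : recip 1 'X = 1 :> {poly R}.
Proof. by have := @recipXn 1 1 isT; rewrite expr1 subnn expr0. Qed.

Lemma poly_monomials d p : (size p <= d.+1)%N -> p = \sum_(i < d.+1) p`_i *: 'X^i.
Proof.
move=> sp; rewrite -poly_def; apply/polyP => i; rewrite coef_poly.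
by case: ltnP => // le_di; rewrite nth_default // (leq_trans sp).
Qed.

Lemma recip_monomials d p : (size p <= d.+1)%N ->
  recip d p = \sum_(i < d.+1) p`_i *: 'X^(d - i).
Proof.
move=> sp; rewrite {1}(poly_monomials sp) recip_sum; apply: eq_bigr => i _.
by rewrite recipZ recipXn // -ltnS.
Qed.

Lemma recipM d e p q : (size p <= d.+1)%N -> (size q <= e.+1)%N ->
  recip (d + e) (p * q) = recip d p * recip e q.
Proof.
move=> sp sq; rewrite (recip_monomials sp) (recip_monomials sq).
rewrite {1}(poly_monomials sp) {1}(poly_monomials sq) !big_distrlr /= recip_sum.
apply: eq_bigr => i _; rewrite recip_sum; apply: eq_bigr => j _.
have [li lj] := (ltn_ord i, ltn_ord j).
rewrite -!scalerAl -!scalerAr !scalerA -!exprD recipZ recipXn; last by lia.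
by congr (_ *: 'X^_); lia.
Qed.

Lemma size_exp_bound d p n : (size p <= d.+1)%N -> (size (p ^+ n) <= (d * n).+1)%N.
Proof.
move=> sp; apply: leq_trans (size_poly_exp_leq p n) _; rewrite ltnS leq_mul2r.
by apply/orP; right; lia.
Qed.

Lemma recipX d p n : (size p <= d.+1)%N -> recip (d * n) (p ^+ n) = recip d p ^+ n.
Proof.
move=> sp; elim: n => [|n IHn]; first by rewrite muln0 !expr0 -(expr0 'X) recipXn.
by rewrite mulnS !exprS recipM ?IHn // size_exp_bound.
Qed.

(** Hence the product of a polynomial with its reciprocal determines its Euclidean norm. *)
Lemma coef_mul_recip d p : (p * recip d p)`_d = \sum_(i < d.+1) p`_i ^+ 2.
Proof.
rewrite coefM; apply: eq_bigr => i _.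
by rewrite coef_recip leq_subr subKn ?expr2 // -ltnS.
Qed.

End Reciprocal.

Lemma map_recip (R S : comNzRingType) (f : {rmorphism R -> S}) d (p : {poly R}) :
  map_poly f (recip d p) = recip d (map_poly f p).
Proof.
by apply/polyP => i; rewrite coef_map /= !coef_recip coef_map; case: ifP; rewrite ?rmorph0.
Qed.

(** * Lifting to two variables *)

Section Kronecker.
Variable R : comNzRingType.

(** The inner variable is x and the outer one y, so this bounds the degree in x. *)
Definition coef_size_le (s : nat) (P : {poly {poly R}}) :=
  forall i : nat, (size (P`_i)%R <= s)%N.

Lemma coef_size_leM s t P Q : coef_size_le s.+1 P -> coef_size_le t.+1 Q ->
  coef_size_le (s + t).+1 (P * Q).
Proof.
move=> hP hQ i; rewrite coefM; apply/(leq_trans (size_sum _ _ _))/bigmax_leqP => j _.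
apply: leq_trans (size_polyMleq _ _) _.
by have := hP j; have := hQ (i - j)%N; lia.
Qed.

Lemma coef_size_leB s P Q : coef_size_le s P -> coef_size_le s Q -> coef_size_le s (P - Q).
Proof.
move=> hP hQ i; rewrite coefB; apply: leq_trans (size_polyD _ _) _.
by rewrite geq_max size_polyN hP hQ.
Qed.

Lemma coef_size_leW s t P : (s <= t)%N -> coef_size_le s P -> coef_size_le t P.
Proof. by move=> st hP i; exact: leq_trans (hP i) st. Qed.

(** Under y = x^k, coefficients of x-degree below k fill disjoint blocks of exponents, so nothing
    cancels between them. *)
Lemma kronecker_inj k P : coef_size_le k P -> P.['X^k] = 0 -> P = 0.
Proof.
elim/poly_ind: P => [//|P c IHP] hP; rewrite hornerMXaddC => E.
have sc : (size c <= k)%N by have := hP 0%N; rewrite coefD coefMX coefC add0r.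
have c0 : c = 0.
  apply/polyP => i; rewrite coef0; case: (ltnP i k) => [ik|ki].
    by have := congr1 (fun p : {poly R} => p`_i) E; rewrite coefD coefMXn ik coef0 add0r.
  by rewrite nth_default // (leq_trans sc).
rewrite c0 polyC0 addr0 in hP E *.
suff -> : P = 0 by rewrite mul0r.
apply: IHP => [i|]; first by have := hP i.+1; rewrite coefMX.
apply/polyP => i; have := congr1 (fun p : {poly R} => p`_(i + k)) E.
by rewrite coef0 addr0 coefMXn ltnNge leq_addl /= addnK coef0.
Qed.

(* The factor 'X^S keeps the exponents t + S - k (a t) of x nonnegative. *)
Lemma kronecker_lift k S q D (a : nat -> nat) (W : {poly R}) : (size W <= D.+1)%N ->
  (forall t, W`_t != 0 -> [/\ a t <= q, k * a t <= t + S & t <= k * a t + S]%N) ->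
  exists P : {poly {poly R}}, [/\ coef_size_le (2 * S).+1 P, (size P <= q.+1)%N &
    P.['X^k] = 'X^S * W].
Proof.
move=> sW ha.
exists (\sum_(t < D.+1) (W`_t *: 'X^(t + S - k * a t))%:P * 'X^(a t)); split.
- move=> i; rewrite coef_sum; apply/(leq_trans (size_sum _ _ _))/bigmax_leqP => t _.
  rewrite coefCM coefXn; have [->|W0] := eqVneq W`_t 0.
    by rewrite scale0r mul0r size_poly0.
  have [h1 h2 h3] := ha _ W0; case: eqP => _; last by rewrite mulr0 size_poly0.
  rewrite mulr1; apply: leq_trans (size_scale_leq _ _) _.
  by rewrite size_polyXn; lia.
- apply/(leq_trans (size_sum _ _ _))/bigmax_leqP => t _.
  have [->|W0] := eqVneq W`_t 0; first by rewrite scale0r polyC0 mul0r size_poly0.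
  have [h1 h2 h3] := ha _ W0; rewrite mul_polyC.
  by apply: leq_trans (size_scale_leq _ _) _; rewrite size_polyXn ltnS.
rewrite horner_sum [in RHS](poly_monomials sW) mulr_sumr; apply: eq_bigr => t _.
have [->|W0] := eqVneq W`_t 0.
  by rewrite !scale0r polyC0 mul0r horner0 mulr0.
have [h1 h2 h3] := ha _ W0.
rewrite hornerM hornerC hornerXn -exprM -scalerAl -scalerAr -!exprD.
by congr (_ *: 'X^_); lia.
Qed.

End Kronecker.

Lemma tofrac_inj (R : idomainType) : injective (@FracField.tofrac R).
Proof. by move=> x y /eqP; rewrite tofrac_eq => /eqP. Qed.

(** * Divisibility from clustered exponents *)

Section Clusters.
Variables (m q r S k : nat) (a : nat -> nat) (W : {poly rat}).
Hypotheses (m_gt0 : (0 < m)%N) (q_gt0 : (0 < q)%N) (cop : gcdn q (gcdn m r) = 1%N).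
Hypotheses (leS : (2 * m + r <= S)%N) (ltk : (6 * S < k)%N).
Let D := (k * q + r + 2 * m)%N.
Let F : {poly rat} := ('X * ('X + 1)) ^+ m * 'X^(k * q + r) - ('X - 1) ^+ m.
(** For odd [m] this is the reciprocal of [F] in degree [D]. *)
Let Fr : {poly rat} := ('X - 1) ^+ m * 'X^(m + (k * q + r)) + ('X + 1) ^+ m.
Hypotheses (sW : (size W <= D.+1)%N) (EW : W * recip D W = F * Fr).
Hypothesis ha : forall t, W`_t != 0 ->
  [/\ a t <= q, k * a t <= t + S & t <= k * a t + S]%N.

Let c1 : {poly rat} := ('X * ('X + 1)) ^+ m * 'X^r.
Let c0 : {poly rat} := ('X - 1) ^+ m.

Lemma coprimep_FX n : coprimep F 'X^n.
Proof.
apply: coprimep_expr; rewrite -['X]subr0 -polyC0 coprimep_XsubC /root.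
rewrite /F !(hornerE, hornerM, horner_exp, hornerD, hornerN) /=.
by rewrite expr0n gtn_eqF // mul0r sub0r oppr_eq0 expf_neq0.
Qed.

Lemma coprimep_Fc1 : coprimep F c1.
Proof.
rewrite coprimepMr coprimep_FX andbT; apply: coprimep_expr.
rewrite coprimepMr -['X]expr1 coprimep_FX expr1 /=.
have -> : 'X + 1 = 'X - (-1)%:P :> {poly rat} by rewrite polyCN opprK.
rewrite coprimep_XsubC /root /F.
rewrite !(hornerE, hornerM, horner_exp, hornerD, hornerN) /=.
by rewrite expr0n gtn_eqF // mul0r sub0r oppr_eq0 expf_neq0.
Qed.

(** At y = x^k the binomial becomes [F]. The extra factors [c1] and 'X^s cancel because [F] does not
    vanish at 0 or -1. *)
Lemma cluster_evaluation s (T : {poly {poly rat}}) V :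
  T.['X^k] = 'X^s * V -> c1%:P * T = (T`_q)%:P * (c1%:P * 'X^q - c0%:P) -> F %| V.
Proof.
move=> eT /(congr1 (fun R : {poly {poly rat}} => R.['X^k])).
rewrite !(hornerM, hornerD, hornerN, hornerC, hornerXn) -exprM eT.
have -> : c1 * 'X^(k * q) - c0 = F by rewrite /c1 /F -mulrA -exprD addnC.
move=> E; have : F %| c1 * ('X^s * V) by rewrite E dvdp_mull.
by rewrite (Gauss_dvdpr _ coprimep_Fc1) (Gauss_dvdpr _ (coprimep_FX s)).
Qed.

Lemma size_c1 : (size c1 <= (2 * m + r).+1)%N.
Proof.
apply: leq_trans (size_polyMleq _ _) _; rewrite size_polyXn.
have : (size ('X * ('X + 1) : {poly rat})%R <= 2.+1)%N.
  by rewrite (leq_trans (size_polyMleq _ _)) // size_polyX size_XaddC.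
by move=> /(size_exp_bound m); rewrite addnS /= -addSn leq_add2r.
Qed.

Lemma coef_size_le_binomial n (u v : {poly rat}) :
  (size u <= n)%N -> (size v <= n)%N -> coef_size_le n (u%:P * 'X^q - v%:P).
Proof.
move=> su sv; apply: coef_size_leB => i.
  by rewrite coefCM coefXn; case: eqP; rewrite ?mulr1 ?mulr0 ?size_poly0.
by rewrite coefC; case: eqP; rewrite ?size_poly0.
Qed.

Lemma dvdp_of_clusters : F %| W \/ F %| recip D W.
Proof.
have [P [xP sP eP]] := kronecker_lift sW ha.
(* Reversal sends t to D - t, and D exceeds k q by 2m + r, so the cluster q - a (D - t) has an error
   larger by that amount. *)
set S' := (S + (2 * m + r))%N.
have ha' t : (recip D W)`_t != 0 ->
    [/\ q - a (D - t) <= q, k * (q - a (D - t)) <= t + S'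
      & t <= k * (q - a (D - t)) + S']%N.
  rewrite coef_recip; case: leqP => [tD W0|]; last by rewrite eqxx.
  have [h1 h2 h3] := ha W0.
  have h4 : (k * a (D - t) <= k * q)%N by rewrite leq_mul2l h1 orbT.
  by rewrite mulnBr /S'; split; rewrite /D in tD h2 h3 h4 *; lia.
have [Q [xQ sQ eQ]] := kronecker_lift (size_recip D W) ha'.
pose d1 : {poly rat} := ('X - 1) ^+ m * 'X^(m + r).
pose d0 : {poly rat} := ('X + 1) ^+ m.
have sX1 : size ('X + 1 : {poly rat}) = 2 by exact: size_XaddC.
have sXm1 : size ('X - 1 : {poly rat}) = 2 by exact: size_XsubC.
have c10 : c1 != 0.
  by rewrite !(mulf_neq0, expf_neq0) ?polyX_eq0 // -size_poly_eq0 sX1.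
have sm1 : (size c0 <= (1 * m).+1)%N by rewrite size_exp_bound // sXm1.
have sp1 : (size d0 <= (1 * m).+1)%N by rewrite size_exp_bound // sX1.
have sd1 : (size d1 <= (2 * m + r).+1)%N.
  rewrite (leq_trans (size_polyMleq _ _)) // size_polyXn addnS /=.
  by rewrite (leq_trans (leq_add sm1 (leqnn _))) //; lia.
have PQ : P * Q = ('X^(S + S'))%:P * (d1%:P * 'X^q - (- d0)%:P) * (c1%:P * 'X^q - c0%:P).
  apply/eqP; rewrite -subr_eq0; apply/eqP.
  (* The x-degree is at most 2S + 2S' on the left and S + S' + 2 (2m + r) on the right, both at most
     6S < k; so it suffices to compare the two sides at y = x^k. *)
  apply: (@kronecker_inj _ k).
    apply: coef_size_leB.
      by apply: coef_size_leW (coef_size_leM xP xQ); rewrite /S'; lia.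
    have h1 : coef_size_le (S + S').+1 ('X^(S + S') : {poly rat})%:P.
      by move=> i; rewrite coefC; case: eqP; rewrite ?size_poly0 ?size_polyXn.
    have h2 : coef_size_le (2 * m + r).+1 (c1%:P * 'X^q - c0%:P).
      by apply: coef_size_le_binomial; [exact: size_c1 | apply: leq_trans sm1 _; lia].
    have h3 : coef_size_le (2 * m + r).+1 (d1%:P * 'X^q - (- d0)%:P).
      by apply: coef_size_le_binomial; rewrite ?size_polyN //; apply: leq_trans sp1 _; lia.
    by apply: coef_size_leW (coef_size_leM (coef_size_leM h1 h3) h2); rewrite /S'; lia.
  rewrite !(hornerM, hornerD, hornerN, hornerC, hornerXn) eP eQ -exprM.
  apply/eqP; rewrite subr_eq0 opprK; apply/eqP.
  rewrite mulrACA EW -exprD [F * _]mulrC mulrA; congr (_ * _ * _); last first.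
    by rewrite /c1 /F -mulrA -exprD addnC.
  by rewrite /d1 /Fr -mulrA -exprD addnAC addnA.
have dg G := @binomial_factor_degree m r q G q_gt0 cop.
have [h|h] := binomial_dvdp_mul (@tofrac_inj _) q_gt0 c10 dg sP sQ PQ.
  by left; apply: cluster_evaluation eP h.
by right; apply: cluster_evaluation eQ h.
Qed.

End Clusters.

(** * Factorizations of FW *)

Definition FWrecip (m n : nat) : {poly rat} :=
  ('X - 1) ^+ m * 'X^(m + 4 * n) + ('X + 1) ^+ m.

Lemma recip_quad (R : comNzRingType) m :
  recip (2 * m) (('X * ('X + 1)) ^+ m : {poly R}) = ('X + 1) ^+ m.
Proof.
rewrite recipX; last first.
  by rewrite (leq_trans (size_polyMleq _ _)) // size_polyX size_XaddC.
rewrite (@recipM _ 1 1) ?size_polyX ?size_XaddC // recipD recip1 recip_polyX.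
by rewrite expr1 mul1r addrC.
Qed.

(** Reversing x - 1 gives 1 - x; the sign survives the power because [m] is odd. *)
Lemma recip_linear (R : comNzRingType) m e : odd m ->
  recip (m + e) (('X - 1) ^+ m : {poly R}) = - (('X - 1) ^+ m * 'X^e).
Proof.
move=> om; rewrite -[X in recip _ X]mulr1 recipM ?size_poly1 //; last first.
  by rewrite -[X in (_ <= X.+1)%N](mul1n m) size_exp_bound // size_XsubC.
rewrite -{1}(mul1n m) recipX ?size_XsubC // recipD recipN !recip1 recip_polyX expr1.
by rewrite -opprB exprNn -signr_odd om expr1 mulN1r mulNr.
Qed.

Lemma recip_FW m n : odd m -> recip (4 * n + 2 * m) (FW m n) = FWrecip m n.
Proof.
move=> om; rewrite /FW recipD recipN.
have -> : (4 * n + 2 * m = m + (m + 4 * n))%N by lia.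
rewrite recip_linear // opprK addrC; congr (_ + _).
have -> : (m + (m + 4 * n) = 2 * m + 4 * n)%N by lia.
rewrite recipM ?size_polyXn //; last first.
  by rewrite size_exp_bound // (leq_trans (size_polyMleq _ _)) // size_polyX size_XaddC.
by rewrite recip_quad recipXn // subnn expr0 mulr1.
Qed.

Lemma size_FW m n : (0 < n)%N -> size (FW m n) = (4 * n + 2 * m).+1.
Proof.
move=> n0; have sq : size ('X * ('X + 1) : {poly rat}) = 3.
  by rewrite mulrC size_mulX -?size_poly_eq0 ?size_XaddC.
have sqm : size (('X * ('X + 1)) ^+ m * 'X^(4 * n) : {poly rat}) = (4 * n + 2 * m).+1.
  rewrite size_mulXn ?expf_neq0 -?size_poly_eq0 ?sq // addnC.
  have := size_exp ('X * ('X + 1) : {poly rat}) m; rewrite sq.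
  move: (size _) (size_poly_gt0 (('X * ('X + 1)) ^+ m : {poly rat})) => s.
  by rewrite expf_neq0 -?size_poly_eq0 ?sq //; lia.
have sl : (size (('X - 1) ^+ m : {poly rat}) <= (1 * m).+1)%N.
  by rewrite size_exp_bound // size_XsubC.
by rewrite size_polyDl sqm // size_polyN (leq_ltn_trans sl) //; lia.
Qed.

Definition support_seq (W : {poly int}) (D : nat) :=
  [seq i <- iota 0 D.+1 | W`_i != 0].

(** A nonzero integer has square at least 1; this is why factors are taken over the integers. *)
Lemma size_support (W : {poly int}) D :
  (size (support_seq W D))%:Z <= \sum_(i < D.+1) W`_i ^+ 2.
Proof.
rewrite -(big_mkord xpredT (fun i => W`_i ^+ 2)) /index_iota subn0.
rewrite size_filter -sum1_count -natz natr_sum big_mkcond /=.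
apply: ler_sum => i _; case: ifP => [W0|_]; last exact: sqr_ge0.
by rewrite -gtz0_ge1 exprn_even_gt0.
Qed.

Definition FZ (m n : nat) : {poly int} :=
  ('X * ('X + 1)) ^+ m * 'X^(4 * n) - ('X - 1) ^+ m.

Lemma FZ_FW m n : pZtoQ (FZ m n) = FW m n.
Proof.
by rewrite /FZ /FW !(rmorphB, rmorphM, rmorphXn, rmorphD, rmorph1) /= map_polyX.
Qed.

(** The inequality (x - y)^2 <= 2 x^2 + 2 y^2 separates the two terms of [FZ], and the shift by
    'X^(4 * n) leaves the norm of the first one unchanged. *)
Lemma FZ_norm_bound m : odd m -> exists M : nat, forall n,
  \sum_(i < (4 * n + 2 * m).+1) (FZ m n)`_i ^+ 2 <= M%:Z.
Proof.
move=> om.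
pose f : {poly int} := ('X * ('X + 1)) ^+ m.
pose g : {poly int} := ('X - 1) ^+ m.
(* The sum of the squared norms of [f] and [g], written without n; for odd [m] the reciprocal of [g]
   in degree m is - g. *)
pose c := (f * recip (2 * m) f)`_(2 * m) + (- (g * g))`_m.
exists (absz (2 * c)%R) => n; apply: le_trans (lez_abs _).
have sf : (size f <= (2 * m).+1)%N.
  by rewrite size_exp_bound // (leq_trans (size_polyMleq _ _)) // size_polyX size_XaddC.
set D := (4 * n + 2 * m)%N.
have -> : c = \sum_(i < D.+1) ((f * 'X^(4 * n))`_i ^+ 2 + g`_i ^+ 2).
  rewrite big_split /= -!coef_mul_recip /D; congr (_ + _).
    rewrite (addnC (4 * n)%N) recipM ?size_polyXn //  recipXn // subnn expr0 mulr1.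
    by rewrite mulrAC coefMXn ltnNge leq_addl /= addnK.
  have -> : (4 * n + 2 * m = m + (m + 4 * n))%N by lia.
  rewrite recip_linear // -/g mulrN mulrA !coefN coefMXn.
  by rewrite ltnNge leq_addl /= addnK.
rewrite mulr_sumr; apply: ler_sum => i _.
rewrite /FZ -/f -/g coefB; move: (_`_i) (g`_i) => x y.
rewrite -subr_ge0 (_ : _ - _ = (x + y) ^+ 2) ?sqr_ge0 //; ring.
Qed.

(** A common divisor of q, m and r divides 4n, which is coprime to the odd number m. *)
Lemma coprime_remainder m n q k r : odd m -> coprime n m -> (4 * n = k * q + r)%N ->
  gcdn q (gcdn m r) = 1%N.
Proof.
move=> om cop E; set p := gcdn _ _.
have pq : (p %| q)%N := dvdn_gcdl _ _.
have pm : (p %| m)%N := dvdn_trans (dvdn_gcdr _ _) (dvdn_gcdl _ _).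
have pr : (p %| r)%N := dvdn_trans (dvdn_gcdr _ _) (dvdn_gcdr _ _).
have pn : (p %| 4 * n)%N by rewrite E dvdn_add // dvdn_mull.
apply/eqP; rewrite -dvdn1.
have <- : gcdn (4 * n) m = 1%N.
  by apply/eqP; rewrite -/(coprime _ _) coprimeMl cop andbT (@coprimeXl 2 2) // coprime2n.
by rewrite dvdn_gcd pn pm.
Qed.

Lemma factor_dvdp_FWrecip (m : nat) : (0 < m)%N -> odd m ->
  exists N : nat, forall n, (0 < n)%N -> (N <= n)%N -> coprime n m ->
  forall A B : {poly rat}, FW m n = A * B -> A %| FWrecip m n \/ B %| FWrecip m n.
Proof.
move=> m0 om; have [M hM] := FZ_norm_bound om.
have [N hN] := exponent_clusters m M; exists N => n n0 leNn cop A B EAB.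
have sF := size_FW m n0; set D := (4 * n + 2 * m)%N in sF hM.
have F0 : FW m n != 0 by rewrite -size_poly_eq0 sF.
(* Gauss's lemma replaces [A] and [B] by integer polynomials, up to nonzero rational scalars. *)
have /dvdpP_rat_int[A1 [c c0 EA] [B1 E1]] : A %| pZtoQ (FZ m n).
  by rewrite FZ_FW EAB dvdp_mulr.
have EF : FW m n = pZtoQ A1 * pZtoQ B1 by rewrite -FZ_FW E1 rmorphM.
have A10 : pZtoQ A1 != 0 by apply: contraNneq F0 => A0; rewrite EF A0 mul0r.
have B10 : pZtoQ B1 != 0 by apply: contraNneq F0 => B0; rewrite EF B0 mulr0.
have EB : c *: B = pZtoQ B1.
  by apply: (mulfI A10); rewrite -EF EAB EA -scalerAl -scalerAr.
rewrite EA dvdpZl // -(dvdpZl B _ c0) EB.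
set dA := (size A1).-1; set dB := (size B1).-1.
have sA : size A1 = dA.+1.
  by rewrite prednK // -(size_rat_int_poly A1) size_poly_gt0.
have sB : size B1 = dB.+1.
  by rewrite prednK // -(size_rat_int_poly B1) size_poly_gt0.
have ED : D = (dA + dB)%N.
  apply/eqP; rewrite -eqSS -sF EF size_mul // !size_rat_int_poly sA sB.
  by rewrite addSn addnS.
pose W := recip dA A1 * B1.
have recW : recip D W = A1 * recip dB B1.
  by rewrite ED recipM ?size_recip ?sB // recipK ?sA.
have recF : recip D (FZ m n) = recip dA A1 * recip dB B1.
  by rewrite ED E1 recipM ?sA ?sB.
have EW : W * recip D W = FZ m n * recip D (FZ m n).
  by rewrite recW recF E1 /W; ring.
have sW : (size W <= D.+1)%N.
  rewrite (leq_trans (size_polyMleq _ _)) // sB addnS /= ED -addSn leq_add2r.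
  exact: size_recip.
have recFQ : FWrecip m n = recip dA (pZtoQ A1) * recip dB (pZtoQ B1).
  by rewrite -recip_FW // -FZ_FW -map_recip recF rmorphM /= !map_recip.
(* By [EW], [W] and [FZ m n] have the same norm. *)
have supM : (size (support_seq W D) <= M)%N.
  rewrite -lez_nat (le_trans (size_support W D)) // -coef_mul_recip EW.
  by rewrite coef_mul_recip hM.
have supD : all (fun t => t <= 4 * n + 2 * m)%N (support_seq W D).
  by apply/allP => t; rewrite mem_filter mem_iota ltnS => /andP[_ /andP[_]].
have [q [k [r [S [a [q0 E leS ltk ha]]]]]] := hN n leNn _ supM supD.
have ha' t : (pZtoQ W)`_t != 0 -> [/\ a t <= q, k * a t <= t + S & t <= k * a t + S]%N.
  rewrite coef_map intr_eq0 => W0; apply: ha; rewrite mem_filter W0 mem_iota /=.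
  by rewrite (leq_trans _ sW) // ltnNge; apply: contra W0 => /(nth_default 0) ->.
have sWQ : (size (pZtoQ W) <= (k * q + r + 2 * m).+1)%N by rewrite size_rat_int_poly -E.
have := dvdp_of_clusters m0 q0 (coprime_remainder om cop E) leS ltk sWQ _ ha'.
rewrite -E -/D -/(FW m n) -/(FWrecip m n) -map_recip recW => hF.
case: hF => [| |].
- by rewrite -rmorphM -recW EW rmorphM /= FZ_FW map_recip FZ_FW recip_FW.
(* Cancelling [B1] from F | W leaves that [A1] divides its own reciprocal, a factor of [FWrecip].
   The other case is symmetric. *)
- rewrite EF rmorphM /= dvdp_mul2r // map_recip => dvA; left.
  by rewrite recFQ dvdp_mulr.
rewrite EF rmorphM /= dvdp_mul2l // map_recip => dvB; right.
by rewrite recFQ dvdp_mull.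
Qed.

(** * The factor x^2 + 1 and the roots shared with the reciprocal *)

Lemma quadratic_dvdp_FW m n : 'X ^+ 2 + 1 %| FW m n.
Proof.
(* The first difference is divisible by x(x + 1) - (x - 1) = x^2 + 1, the second by x^4 - 1. *)
have -> : FW m n = (('X * ('X + 1)) ^+ m - ('X - 1) ^+ m)
                   + ('X * ('X + 1)) ^+ m * (('X ^+ 4) ^+ n - 1 ^+ n).
  by rewrite /FW expr1n -exprM; ring.
rewrite !subrXX dvdp_add //.
  by apply: dvdp_mulr; rewrite (_ : _ - _ = 'X ^+ 2 + 1) //; ring.
apply/dvdp_mull/dvdp_mulr; rewrite (_ : _ - _ = ('X ^+ 2 + 1) * ('X ^+ 2 - 1)).
  exact: dvdp_mulIl.
ring.
Qed.

(** With y = x^(m + 4n), u = (x + 1)^m and v = (x - 1)^m, the equations read y u = v and y v = - u.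
    Hence y^2 = -1, so x has modulus 1 and is equidistant from 1 and -1. *)
Lemma common_root_sqr (m n : nat) (x : algC) : (0 < m)%N ->
  (x * (x + 1)) ^+ m * x ^+ (4 * n) - (x - 1) ^+ m = 0 ->
  (x - 1) ^+ m * x ^+ (m + 4 * n) + (x + 1) ^+ m = 0 -> x ^+ 2 = -1.
Proof.
move=> m0; rewrite exprMn mulrAC -exprD.
set y := x ^+ _; set u := (x + 1) ^+ m; set v := (x - 1) ^+ m => /subr0_eq Ev E.
have u0 : u != 0.
  apply/eqP => u0; have : v = 0 by rewrite -Ev u0 mulr0.
  move/eqP; move/eqP: u0; rewrite !expf_eq0 m0 /= addr_eq0 subr_eq0 => /eqP-> /eqP.
  by move=> /eqP; rewrite eq_sym -addr_eq0 -(natrD _ 1 1) pnatr_eq0.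
have y2 : y ^+ 2 = -1.
  apply: (mulIf u0); apply/eqP; rewrite -subr_eq0; apply/eqP.
  by rewrite -[RHS]E -Ev; ring.
have ny : `|y| = 1.
  apply/eqP; rewrite -(@pexpr_eq1 _ _ 2) // -normrX y2 normrN1 //.
have nx : `|x| = 1.
  apply/eqP; rewrite -(@pexpr_eq1 _ _ (m + 4 * n)) ?normr_ge0 //; last by lia.
  by rewrite -normrX -/y ny.
have nuv : `|x - 1| = `|x + 1|.
  by apply: (pexpIrn m0); rewrite ?nnegrE ?normr_ge0 // -!normrX -/u -/v -Ev normrM ny mul1r.
have := congr1 (fun t => t ^+ 2) nuv; have := congr1 (fun t => t ^+ 2) nx.
rewrite !normCK rmorphB rmorphD rmorph1 expr1n; set z := x^* => xz Ez.
(* Equal distances to 1 and -1 make x purely imaginary; [z] is its conjugate. *)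
have : 2%:R * (x + z) = 0.
  have -> : 2%:R * (x + z) = (x + 1) * (z + 1) - (x - 1) * (z - 1) by ring.
  by rewrite Ez subrr.
move/eqP; rewrite mulf_eq0 pnatr_eq0 /= addr_eq0 => /eqP xE.
by rewrite -xz expr2 {2}xE; ring.
Qed.

(** If h vanished at x, so would the derivative of the left side. As x (x + 1) = x - 1 and x^(4n) =
    1, that derivative is (x - 1)^(m - 1) ((2m + 4n) x + 4n). Squaring (2m + 4n) x = - 4n would give
    (2m + 4n)^2 + (4n)^2 = 0. *)
Lemma simple_root (m n : nat) (h : {poly algC}) (x : algC) : (0 < m)%N -> (0 < n)%N ->
  ('X * ('X + 1)) ^+ m * 'X ^+ (4 * n) - ('X - 1) ^+ m = ('X ^+ 2 + 1) * h ->
  x ^+ 2 = -1 -> h.[x] != 0.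
Proof.
move=> m0 n0 E x2; apply/eqP => h0.
have := congr1 (fun p => p^`().[x]) E.
rewrite derivM hornerD !hornerM h0 mulr0 add0r.
have -> : ('X ^+ 2 + 1 : {poly algC}).[x] = 0 by rewrite !hornerE x2 addNr.
rewrite mul0r !(derivB, derivM, derivD, deriv_exp, derivX, derivC, derivXn).
rewrite -polyC1 !(hornerE, hornerMn) /=.
have xq : x * (x + 1) = x - 1 by rewrite mulrDr mulr1 -expr2 x2 addrC.
have x4 : x ^+ (4 * n) = 1 by rewrite exprM (exprM x 2 2) x2 sqrrN !expr1n.
have x4' : x ^+ (4 * n).-1 = - x.
  have := x4; rewrite -[in LHS](@prednK (4 * n)) ?muln_gt0 // exprS => xt.
  by rewrite -[RHS]mulr1 -xt mulrA mulNr -expr2 x2 opprK mul1r.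
have xm : (x - 1) ^+ m = (x - 1) * (x - 1) ^+ m.-1 by rewrite -exprS prednK.
rewrite xq x4 x4' xm; set w := (x - 1) ^+ m.-1 => dF0.
have : w * ((2 * m + 4 * n)%:R * x + (4 * n)%:R) = 0.
  rewrite -[RHS]dF0 natrD !natrM; apply/eqP; rewrite -subr_eq0; apply/eqP.
  transitivity (w * 4 * n%:R * (1 + x ^+ 2)); first by ring.
  by rewrite x2 subrr mulr0.
have w0 : w != 0.
  rewrite expf_neq0 // subr_eq0; apply: contra_eq_neq x2 => ->.
  by rewrite expr1n -addr_eq0 -(natrD _ 1 1) pnatr_eq0.
move/eqP; rewrite mulf_eq0 (negPf w0) /= addr_eq0 => /eqP/(congr1 (fun t => t ^+ 2)).
rewrite exprMn x2 sqrrN mulrN1 => /eqP; rewrite eq_sym -addr_eq0.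
by rewrite -!natrX -natrD pnatr_eq0; lia.
Qed.

Lemma dvdp_FW_FWrecip_root (m n : nat) (P : {poly rat}) : (0 < m)%N ->
  size P != 1%N -> P %| FW m n -> P %| FWrecip m n ->
  exists2 x : algC, x ^+ 2 = -1 & root (pQtoC P) x.
Proof.
move=> m0 sP dvF dvR.
have /closed_rootP[x Px] : size (pQtoC P) != 1%N by rewrite size_map_poly.
exists x => //; apply: (common_root_sqr (n := n) m0).
  have : root (pQtoC (FW m n)) x.
    by case/dvdpP: dvF => c ->; rewrite rmorphM rootM Px orbT.
  rewrite /FW !(rmorphB, rmorphM, rmorphXn, rmorphD, rmorph1) /= map_polyX.
  by move/rootP; rewrite !hornerE.
have : root (pQtoC (FWrecip m n)) x.
  by case/dvdpP: dvR => c ->; rewrite rmorphM rootM Px orbT.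
rewrite /FWrecip !(rmorphB, rmorphM, rmorphXn, rmorphD, rmorph1) /= map_polyX.
by move/rootP; rewrite !hornerE.
Qed.

Theorem theorem1p1 (m : nat) (hm0 : (0 < m)%N) (hmodd : odd m) :
  exists N : nat, forall n : nat, (1 <= n)%N -> (N <= n)%N -> coprime n m ->
    exists g : {poly rat}, FW m n = ('X ^+ 2 + 1) * g /\ irreducible_poly g.
Proof.
have [N hN] := factor_dvdp_FWrecip hm0 hmodd.
exists N => n n0 leNn cop.
have /dvdpP[g Eg] := quadratic_dvdp_FW m n.
have F0 : FW m n != 0 by rewrite -size_poly_eq0 size_FW.
have sQ : size ('X^2 + 1 : {poly rat}) = 3 by rewrite -polyC1 size_XnaddC.
have g0 : g != 0 by apply: contraNneq F0 => g0; rewrite Eg g0 mul0r.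
exists g; split; first by rewrite mulrC.
have no_root (x : algC) : x ^+ 2 = -1 -> ~~ root (pQtoC g) x.
  move=> x2; have := congr1 pQtoC Eg; rewrite mulrC /FW.
  rewrite !(rmorphB, rmorphM, rmorphXn, rmorphD, rmorph1) /= map_polyX => E.
  exact: simple_root hm0 n0 E x2.
split.
  have := size_FW m n0; rewrite Eg size_mul // -?size_poly_eq0 sQ //.
  by rewrite addn3 /=; lia.
move=> q sq /dvdpP[B EB].
have [/size_poly1P[c c0 Bc]|sB] := boolP (size B == 1%N).
  by rewrite EB Bc mul_polyC eqp_sym eqp_scale.
have dvq : q %| FW m n by rewrite Eg EB mulrAC dvdp_mulIr.
have dvB : B %| FW m n by rewrite Eg EB -mulrA dvdp_mulIl.
(* The factor x^2 + 1 is grouped with [B]. In either case a nonconstant divisor of [g], namely [q]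
   or [B], divides both [FW] and [FWrecip], so it vanishes at a square root of -1, against
   [no_root]. *)
have [dv|dv] : q %| FWrecip m n \/ B * ('X^2 + 1) %| FWrecip m n.
- by apply: (hN n n0 leNn cop); rewrite Eg EB; ring.
- have [x x2 qx] := dvdp_FW_FWrecip_root hm0 sq dvq dv.
  by have := no_root x x2; rewrite EB rmorphM /= rootM qx orbT.
have [x x2 Bx] := dvdp_FW_FWrecip_root hm0 sB dvB (dvdp_trans (dvdp_mulIl _ _) dv).
by have := no_root x x2; rewrite EB rmorphM /= rootM Bx.
Qed.
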